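(* For every positive integer $n$ and every odd positive integer $k$, $z_k(2n)=z_k(2n-1)$.
   Context: A partition of $n$ is a weakly decreasing finite sequence of positive integers (its parts) summing to $n$. $\mathcal O(n)$ is the set of partitions of $n$ all of whose parts are odd. For a partition $\lambda=(\lambda_1,\ldots,\lambda_\ell)$ with $\ell\ge k$, $\mathrm{pre}_k(\lambda)$ is the partition whose parts are the products $\lambda_{i_1}\cdots\lambda_{i_k}$ over all $1\le i_1<\cdots<i_k\le\ell$ (with multiplicity); it is undefined if $\ell<k$. $z_k(n)$ is the number of distinct positive integers $x$ that occur as a part of $\mathrm{pre}_k(\lambda)$ for some $\lambda\in\mathcal O(n)$ with at least $k$ parts; equivalently, the number of integers $x=\lambda_{i_1}\cdots\lambda_{i_k}$ with $i_1<\cdots<i_k$ for some $\lambda\in\mathcal O(n)$. *)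

(* Defs.v *)
From mathcomp Require Import all_boot.

Set Implicit Arguments.
Unset Strict Implicit.
Unset Printing Implicit Defensive.

Definition is_partition (n : nat) (l : seq nat) : bool :=
  [&& sorted geq l, all (leq 1) l & sumn l == n].

Definition is_odd_partition (n : nat) (l : seq nat) : bool :=
  is_partition n l && all odd l.

(* A partition of n has at most n parts, each at most n; filtering the
   sequences within these bounds therefore loses nothing: see
   mem_odd_partitions. *)
Definition odd_partitions (n : nat) : seq (seq nat) :=
  [seq l <- flatten [seq [seq map val (val t) | t : m.-tuple 'I_n.+1]
                    | m <- iota 0 n.+1]
  | is_odd_partition n l].

(* Positions, not values, are chosen, so products are listed with
   multiplicity. This is meaningful only when k <= size l. *)
Definition pre (k : nat) (l : seq nat) : seq nat :=
  sort geq [seq \prod_(i in A) nth 0 l i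
           | A : {set 'I_(size l)} <- enum {set 'I_(size l)} & #|A| == k].

Definition pre_parts (k n : nat) : seq nat :=
  undup (flatten [seq pre k l | l <- odd_partitions n & k <= size l]).

Definition z (k n : nat) : nat := size (pre_parts k n).

Lemma mem_odd_partitions n l : (l \in odd_partitions n) = is_odd_partition n l.
Proof.
rewrite mem_filter; case: (boolP (is_odd_partition n l)) => //; rewrite andTb.
case/andP=> /and3P[_ l_gt0 /eqP sum_l] _.
have sz_l : size l <= n.
  by rewrite -sum_l; elim: l l_gt0 {sum_l} => //= x l IHl /andP[x_gt0 /IHl];
     rewrite -add1n; apply: leq_add.
have le_l : all (fun x => x < n.+1) l.
  apply/allP=> x xl; rewrite ltnS -sum_l.
  elim: l xl {l_gt0 sum_l sz_l} => //= y l IHl.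
  by rewrite inE => /predU1P[->|/IHl/leq_trans->//]; rewrite ?leq_addr ?leq_addl.
apply/flattenP.
exists [seq map val (val t) | t : (size l).-tuple 'I_n.+1].
  by apply/mapP; exists (size l); rewrite // mem_iota.
have sz_t : size [seq (inord x : 'I_n.+1) | x <- l] == size l by rewrite size_map.
apply/mapP; exists (Tuple sz_t); first by rewrite mem_enum.
rewrite /= -map_comp map_id_in // => x /(allP le_l) x_le /=.
by rewrite inordK.
Qed.

Lemma mem_pre_parts k n x :
  x \in pre_parts k n <->
  exists l, [/\ is_odd_partition n l, k <= size l & x \in pre k l].
Proof.
rewrite mem_undup; split=> [/flatten_mapP[l]|[l [Ol szl xl]]].
  by rewrite mem_filter mem_odd_partitions => /andP[szl Ol] xl; exists l.
by apply/flatten_mapP; exists l; rewrite // mem_filter mem_odd_partitions szl.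
Qed.

(* Main.v *)
(** The integers counted by [z k n] are exactly the products of [k] odd numbers
    whose sum is at most [n], since such a list can be completed to a partition
    of [n] by parts equal to 1. A sum of an odd number of odd numbers is odd,
    hence it is at most [2n] if and only if it is at most [2n - 1]. *)
Require Import Defs.
From mathcomp Require Import all_boot.

Lemma odd_sumn (s : seq nat) : all odd s -> odd (sumn s) = odd (size s).
Proof. by elim: s => //= x s IHs /andP[x_odd /IHs]; rewrite oddD x_odd => ->. Qed.

Lemma all_odd_gt0 (s : seq nat) : all odd s -> all (leq 1) s.
Proof. by apply: sub_all => x /odd_gt0. Qed.

(** The ones go last: odd numbers are at least 1, so the order stays weakly decreasing. *)
Lemma is_odd_partition_pad (n : nat) (s : seq nat) :
    all odd s -> sumn s <= n ->
  is_odd_partition n (sort geq s ++ nseq (n - sumn s) 1).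
Proof.
move=> s_odd s_le.
have geq_trans : transitive geq by move=> y x t /= yx ty; apply: leq_trans yx.
have odd_l : all odd (sort geq s ++ nseq (n - sumn s) 1).
  by rewrite all_cat all_sort s_odd all_nseq orbT.
rewrite /is_odd_partition /is_partition odd_l all_odd_gt0 // andbT /=.
apply/andP; split; last first.
  rewrite sumn_cat sumn_nseq mul1n.
  by rewrite (perm_sumn (permEl (perm_sort geq s))) subnKC.
(* As [geq] is transitive, sortedness is a pairwise condition, which splits over the
   concatenation. *)
rewrite sorted_pairwise // pairwise_cat -!sorted_pairwise //.
apply/and3P; split.
- apply/allrelP=> x y; rewrite mem_sort mem_nseq => xs /andP[_ /eqP->].
  exact: odd_gt0 (allP s_odd x xs).
- by apply: sort_sorted => x y; apply: leq_total.
- by elim: (_ - _) => // -[].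
Qed.

(** The first [size s] positions of [s ++ t] form an admissible choice and carry exactly the entries
    of [s]. *)
Lemma prod_mem_pre (s t : seq nat) :
  \prod_(x <- s) x \in pre (size s) (s ++ t).
Proof.
have le_st : size s <= size (s ++ t) by rewrite size_cat leq_addr.
pose A := [set i : 'I_(size (s ++ t)) | i < size s].
have in_A i : (i \in A) = (i < size s) by rewrite inE.
have card_A : #|A| = size s.
  rewrite -sum1_card (eq_bigl _ _ in_A) (big_ord_narrow le_st).
  by rewrite sum1_card card_ord.
rewrite mem_sort; apply/mapP; exists A.
  by rewrite mem_filter mem_enum card_A eqxx.
rewrite (eq_bigl _ _ in_A) (big_ord_narrow le_st) (big_nth 0) big_mkord.
by apply: eq_bigr => i _; rewrite nth_cat /= ltn_ord.
Qed.

Lemma mem_preP (k x : nat) (l : seq nat) :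
  x \in pre k l ->
  exists A : {set 'I_(size l)}, #|A| = k /\ x = \prod_(i in A) nth 0 l i.
Proof.
rewrite mem_sort => /mapP[A]; rewrite mem_filter => /andP[/eqP cardA _] ->.
by exists A.
Qed.

Lemma mem_pre_parts_prod (k n x : nat) :
  x \in pre_parts k n <->
  exists s, [/\ size s = k, all odd s, \prod_(y <- s) y = x & sumn s <= n].
Proof.
split=> [/mem_pre_parts[l [l_part _ /mem_preP[A [cardA ->]]]]|].
  case/andP: l_part => /and3P[_ _ /eqP sum_l] l_odd.
  exists [seq nth 0 l (val i) | i <- enum A]; split.
  - by rewrite size_map -cardE.
  - by apply/allP=> _ /mapP[i _ ->]; apply/(allP l_odd)/mem_nth/ltn_ord.
  - by rewrite big_map big_enum.
  - rewrite sumnE big_map big_enum -sum_l sumnE (big_nth 0) big_mkord.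
    (* The parts at positions outside [A] can only increase the sum. *)
    by rewrite [leqRHS](bigID [in A]) /= leq_addr.
case=> s [<- s_odd <- s_le].
apply/mem_pre_parts; exists (sort geq s ++ nseq (n - sumn s) 1); split.
- exact: is_odd_partition_pad.
- by rewrite size_cat size_sort leq_addr.
(* Sorting changes neither length nor product, so [sort geq s] can serve as the chosen prefix. *)
- rewrite -(size_sort geq s) -(perm_big _ (permEl (perm_sort geq s))).
  exact: prod_mem_pre.
Qed.

Theorem theorem3p8 (n k : nat) (n_gt0 : 0 < n) (k_odd : odd k) :
  z k (2 * n) = z k (2 * n - 1).
Proof.
(* Both lists are free of duplicates, so having the same members gives equal sizes. *)
apply/perm_size/uniq_perm; rewrite ?undup_uniq // => x.
apply/idP/idP=> /mem_pre_parts_prod[s [sz_s s_odd prod_s s_le]];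
  apply/mem_pre_parts_prod; exists s; split=> //.
  (* Since [2 * n] is positive, it remains to exclude [sumn s = 2 * n], which would make [k]
     even. *)
  rewrite subn1 -ltnS prednK ?muln_gt0 // ltn_neqAle s_le andbT.
  apply: contraTneq k_odd => sum_s.
  by rewrite -sz_s -odd_sumn // sum_s oddM.
exact: leq_trans s_le (leq_subr _ _).
Qed.
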